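(* Let $\alpha > 0$, let $\mathcal{H} = (\mathcal{H}_n)_{n\in\mathbb{N}}$ be a sequence of $3$-uniform hypergraphs with $|V(\mathcal{H}_n)| = n$, and let $\mathcal{B} = (\mathcal{B}_n)_{n \in \mathbb{N}}$ with each $\mathcal{B}_n$ a family of subsets of $V(\mathcal{H}_n)$. Suppose $\mathcal{H}$ is $(\alpha,\mathcal{B})$-stable, $e(\mathcal{H}_n) = \Theta(n^2)$ and $\Delta_2(\mathcal{H}_n) = O(1)$. If $\|\mathcal{B}_n\| \geqslant \alpha n$, then for every $\delta > 0$ there exist $C > 0$ and $\varepsilon = \varepsilon(\mathcal{H},\delta) > 0$ such that, if $m \geqslant C\sqrt{n}$ and $n$ is sufficiently large, then $$\big|\mathrm{SF}^{(\delta)}_{\geqslant}(\mathcal{H}_n,\mathcal{B}_n,m)\big| \leqslant \Big( 2^{-\varepsilon m} + \delta^m |\mathcal{B}_n| \Big)\binom{\|\mathcal{B}_n\|}{m}.$$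
   Context: $|\mathcal{B}_n|$ is the number of sets in $\mathcal{B}_n$ and $\|\mathcal{B}_n\| = \max\{|B| : B \in \mathcal{B}_n\}$. The sequence $\mathcal{H}$ is $(\alpha,\mathcal{B})$-stable if for every $\gamma > 0$ there exists $\beta > 0$ such that for every $n$ and every $A \subseteq V(\mathcal{H}_n)$ with $|A| \geqslant (\alpha-\beta)n$, either $e(\mathcal{H}_n[A]) \geqslant \beta\, e(\mathcal{H}_n)$ or $|A\setminus B| \leqslant \gamma n$ for some $B \in \mathcal{B}_n$ ($e$ = number of edges). $\Delta_2(\mathcal{H}_n)$ is the maximum, over pairs $T$ of vertices, of the number of edges containing $T$. $\mathrm{SF}(\mathcal{H}_n,m)$ is the collection of independent sets (vertex sets containing no edge) of size $m$ in $\mathcal{H}_n$, and $\mathrm{SF}^{(\delta)}_{\geqslant}(\mathcal{H}_n,\mathcal{B}_n,m) = \{I \in \mathrm{SF}(\mathcal{H}_n,m) : |I\setminus B| \geqslant \delta m \text{ for every } B \in \mathcal{B}_n\}$. Asymptotic notation refers to $n\to\infty$. *)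

(* Defs.v *)
From mathcomp Require Import all_boot.
From Stdlib Require Import Reals.
Local Open Scope R_scope.
Definition Rleb (x y : R) : bool := if Rle_dec x y then true else false.
Set Implicit Arguments. Unset Strict Implicit. Unset Printing Implicit Defensive.

Definition hgraph (n : nat) := {set {set 'I_n}}.

Definition uniform3 (n : nat) (H : hgraph n) : Prop :=
  forall e, e \in H -> #|e| = 3%nat.

Definition nedges (n : nat) (H : hgraph n) : nat := #|H|.

Definition nedges_in (n : nat) (H : hgraph n) (A : {set 'I_n}) : nat :=
  #|[set e in H | e \subset A]|.

Definition codeg2 (n : nat) (H : hgraph n) : nat :=
  \max_(T : {set 'I_n} | #|T| == 2%nat) #|[set e in H | T \subset e]|.

Definition maxsize (n : nat) (B : {set {set 'I_n}}) : nat :=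
  \max_(X in B) #|X|.

Definition indep (n : nat) (H : hgraph n) (I : {set 'I_n}) : bool :=
  [forall e in H, ~~ (e \subset I)].

Definition SF (n : nat) (H : hgraph n) (m : nat) : {set {set 'I_n}} :=
  [set I : {set 'I_n} | indep H I && (#|I| == m)].

Definition SFge (n : nat) (H : hgraph n) (B : {set {set 'I_n}}) (delta : R)
    (m : nat) : {set {set 'I_n}} :=
  [set I in SF H m | [forall X in B, Rleb (delta * INR m) (INR #|I :\: X|)]].

Definition stable (alpha : R) (H : forall n, hgraph n)
    (B : forall n, {set {set 'I_n}}) : Prop :=
  forall gamma : R, 0 < gamma -> exists beta : R, 0 < beta /\
    forall (n : nat) (A : {set 'I_n}),
      (alpha - beta) * INR n <= INR #|A| ->
      beta * INR (nedges (H n)) <= INR (nedges_in (H n) A) \/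
      exists X, X \in B n /\ INR #|A :\: X| <= gamma * INR n.

(* Main.v *)
Require Import Defs.
From Stdlib Require Import Reals Lra.
From mathcomp Require Import all_boot zify.
Set Implicit Arguments. Unset Strict Implicit. Unset Printing Implicit Defensive.

(** The proof is a container argument. Given an independent set [I], query the
    vertices of the current container [A] in order of decreasing degree until
    about [sqrt n] vertices [U] of [I] have been found; if the degrees drop
    below a small multiple of [n] first, [A] already spans few edges. [I] is
    independent in the link graph of [U], which has about [n ^ (3/2)] edges and,
    by the codegree bound, maximum degree [O(sqrt n)], so the Kleitman-Winston
    algorithm on this graph finds another [O(sqrt n)] vertices of [I] that
    expel a positive proportion of all vertices from [A]. After boundedly many
    rounds, [I] lies in [T :|: f T] where [T] is a subset of [I] of size
    [O(sqrt n)] and [f T] spans few edges.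

    By stability, [f T] is either smaller than [(alpha - beta) n], or almost
    contained in some [X] in [B n]. In the first case there are exponentially
    fewer choices for [I :\: T] than [m]-subsets of a set of size
    [maxsize (B n)]; in the second, [I] has at least [delta m / 2] elements in
    a set of size [gamma n], which costs a factor [delta ^ m] if [gamma] is
    small. The choice of [T] costs only [exp (2 theta m)] for a small [theta],
    since [#|T|] is at most a small multiple of [m]. *)

(** * Containers *)

(* [T] is the fingerprint of [I] inside [A] and [f T], which depends on [T]
   only, is its container. *)
Definition covered (V : finType) (good : pred {set V}) (adm : {set V} -> Prop)
    (A : {set V}) (b : nat) : Prop :=
  exists f : {set V} -> {set V}, forall I, adm I ->
    exists T : {set V}, [/\ T \subset I :&: A, #|T| <= b,
      I :&: A \subset T :|: f T & good (f T)].

Lemma covered_leaf (V : finType) (good : pred {set V}) adm (A : {set V}) b :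
  good A -> covered good adm A b.
Proof.
move=> gA; exists (fun=> A) => I _; exists set0.
by rewrite sub0set cards0 set0U subsetIr.
Qed.

(* Asking whether [v] lies in [I]: the answer is recorded in the fingerprint,
   so containers for the two answers merge into one function of [T]. *)
Lemma covered_query (V : finType) (good : pred {set V})
    (adm : {set V} -> Prop) (A A1 A2 : {set V}) v b :
  v \in A -> A1 \subset A :\ v -> A2 \subset A :\ v ->
  (forall I, adm I -> v \in I -> I :&: A \subset v |: A1) ->
  (forall I, adm I -> v \notin I -> I :&: A \subset A2) ->
  covered good (fun I => adm I /\ v \in I) A1 b ->
  covered good (fun I => adm I /\ v \notin I) A2 b.+1 ->
  covered good adm A b.+1.
Proof.
move=> vA sA1 sA2 c1 c2 [f1 h1] [f2 h2].
exists (fun T : {set V} => if v \in T then f1 (T :\ v) else f2 T) => I aI.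
have [vI|vI] := boolP (v \in I).
  have [T [sT cT iT gT]] := h1 I (conj aI vI).
  have vT : v \notin T.
    apply/negP => vT; have := subsetP (subset_trans sT (subsetIr _ _)) _ vT.
    by move/(subsetP sA1); rewrite !inE eqxx.
  have eT : (v |: T) :\ v = T.
    by apply/setP => x; rewrite !inE; case: eqP => //= ->; rewrite (negbTE vT).
  exists (v |: T); rewrite setU11 eT; split=> //.
  - rewrite subUset sub1set inE vI vA /=; apply: subset_trans sT _.
    by apply: setIS; apply: subset_trans sA1 (subsetDl _ _).
  - by rewrite cardsU1 vT.
  - apply/subsetP => x xIA; have := subsetP (c1 I aI vI) x xIA.
    rewrite !inE; case: eqP => //= _ xA1.
    have : x \in I :&: A1 by rewrite inE xA1; case/setIP: xIA => ->.
    by move/(subsetP iT); rewrite inE.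
have [T [sT cT iT gT]] := h2 I (conj aI vI).
have vT : v \notin T.
  by apply: contra vI => /(subsetP sT); rewrite inE => /andP[].
exists T; rewrite (negbTE vT); split=> //.
  by apply: subset_trans sT (setIS _ (subset_trans sA2 (subsetDl _ _))).
apply: subset_trans iT; apply/subsetP => x xIA.
by rewrite inE (subsetP (c2 I aI vI) x xIA); case/setIP: xIA => ->.
Qed.

Lemma covered_sub (V : finType) (good : pred {set V})
    (adm adm' : {set V} -> Prop) (A : {set V}) b b' :
  (forall I, adm' I -> adm I) -> b <= b' ->
  covered good adm A b -> covered good adm' A b'.
Proof.
move=> sub lb [f h]; exists f => I /sub /h [T [? cT ? ?]].
by exists T; split=> //; apply: leq_trans cT lb.
Qed.

(** The neighbourhood of [x], within [A], in the link graph of [U]. *)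
Definition nbrs (V : finType) (H : {set {set V}}) (U A : {set V}) (x : V) : {set V} :=
  [set y in A | (y != x) && [exists u in U, u |: [set x; y] \in H]].

(* Kleitman-Winston algorithm on the link graph of [U]: each selected vertex
   removes at least [d] vertices from [A], so at most [b] are selected. *)
Lemma covered_link (V : finType) (H : {set {set V}}) (good : pred {set V})
    (adm : {set V} -> Prop) (U A : {set V}) d b b' :
  0 < d -> (forall I e, adm I -> e \in H -> ~~ (e \subset I)) ->
  (forall I, adm I -> U \subset I) ->
  (forall A' : {set V}, A' \subset A ->
     (forall x, x \in A' -> #|nbrs H U A' x| < d) -> covered good adm A' b') ->
  #|A| <= b * d -> covered good adm A (b + b').
Proof.
move=> d0; elim: {A}#|A| {-2}A (leqnn #|A|) adm b => [|k IH] A.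
  rewrite leqn0 cards_eq0 => /eqP -> adm b _ _ next _.
  apply: (@covered_sub _ _ adm _ _ b') => //; first exact: leq_addl.
  by apply: next => // x; rewrite inE.
move=> cA adm b indI sUI next lA.
have [/existsP[v /andP[vA dv]]|/existsPn small] :=
    boolP [exists v, (v \in A) && (d <= #|nbrs H U A v|)]; last first.
  apply: (@covered_sub _ _ adm _ _ b') => //; first exact: leq_addl.
  apply: next => // x xA; have := small x.
  by rewrite xA /= -ltnNge.
have sN : nbrs H U A v \subset A by apply/subsetP => x; rewrite inE => /andP[].
have sN' : nbrs H U A v \subset A :\ v.
  by apply/subsetP => x; rewrite !inE => /andP[-> /andP[->]].
have cN : #|A :\ v| = #|A|.-1 by rewrite (cardsD1 v A) vA.
have cAv : #|A :\ v| <= k by rewrite cN; lia.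
have cAN : #|(A :\ v) :\: nbrs H U A v| + d <= #|A|.
  by rewrite cardsDS // cN; have := subset_leq_card sN'; rewrite cN; lia.
case: b lA => [|b] lA; first by have := subset_leq_card sN; lia.
rewrite addSn; apply: (@covered_query _ _ _ _ ((A :\ v) :\: nbrs H U A v) (A :\ v) v) => //.
- exact: subsetDl.
- move=> I aI vI; apply/subsetP => x /setIP[xI xA]; rewrite !inE xA /=.
  (* A neighbour [x] of [v] lying in [I] would complete an edge [u, v, x] inside [I], as [U] is
     contained in [I]. *)
  case: (eqVneq x v) => //= xv; rewrite andbT.
  apply/negP => /existsP[u /andP[uU eH]].
  move/negP: (indI I _ aI eH); apply.
  by rewrite !subUset !sub1set vI xI (subsetP (sUI I aI)).
- move=> I aI vI; apply/subsetP => x /setIP[xI xA]; rewrite !inE xA andbT.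
  by apply: contraNneq vI => <-.
- apply: IH => //.
  + by apply: leq_trans cAv; apply: subset_leq_card; apply: subsetDl.
  + by move=> I e [aI _]; apply: indI.
  + by move=> I [aI _]; apply: sUI.
  + move=> A' sA' sm; apply: (@covered_sub _ _ adm _ _ b') => //; first by move=> I [].
    by apply: next => //; apply: subset_trans sA' (subset_trans (subsetDl _ _) (subsetDl _ _)).
  + by lia.
- rewrite -addSn; apply: IH => //.
  + by move=> I e [aI _]; apply: indI.
  + by move=> I [aI _]; apply: sUI.
  + move=> A' sA' sm; apply: (@covered_sub _ _ adm _ _ b') => //; first by move=> I [].
    by apply: next => //; apply: subset_trans sA' (subsetDl _ _).
  + by lia.
Qed.

Lemma card_bigcup_leq_sum (I V : finType) (P : pred I) (F : I -> {set V}) :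
  #|\bigcup_(i | P i) F i| <= \sum_(i | P i) #|F i|.
Proof.
elim/big_rec2: _ => [|i s X _ IH]; first by rewrite cards0.
by apply: leq_trans (leq_card_setU _ _) _; rewrite leq_add2l.
Qed.

Lemma card_bigcup_leq (I V : finType) (A : {set I}) (F : I -> {set V}) c :
  (forall i, i \in A -> #|F i| <= c) -> #|\bigcup_(i in A) F i| <= #|A| * c.
Proof.
move=> h; apply: leq_trans (card_bigcup_leq_sum _ _) _.
by rewrite -sum_nat_const; apply: leq_sum.
Qed.

Definition touching (V : finType) (H : {set {set V}}) (U A : {set V}) : {set {set V}} :=
  [set e in H | (e \subset A) && ~~ [disjoint e & U]].

(* An edge touching [U] either gives an edge of the link graph of [U] inside
   [A], or contains a vertex of [U] and another vertex of [A0 :\: A]. *)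
Lemma card_touching (V : finType) (H : {set {set V}}) (U A0 A : {set V}) K d :
  (forall e, e \in H -> #|e| = 3) ->
  (forall x y, x != y -> #|[set e in H | (x \in e) && (y \in e)]| <= K) ->
  (forall x, x \in A -> #|nbrs H U A x| <= d) ->
  #|touching H U A0| <= #|A| * (d * K) + #|U| * (#|A0 :\: A| * K).
Proof.
move=> unif codeg small.
pose E x y : {set {set V}} := [set e in H | (x \in e) && (y \in e)].
(* The codegree bound concerns distinct vertices only, so the diagonal is made empty. *)
pose E' x y : {set {set V}} := if x == y then set0 else E x y.
have cE' x y : #|E' x y| <= K.
  by rewrite /E'; case: eqVneq => [_|]; [rewrite cards0 | apply: codeg].
pose X := \bigcup_(x in A) \bigcup_(y in nbrs H U A x) E' x y.
pose Y := \bigcup_(u in U) \bigcup_(x in A0 :\: A) E' u x.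
have sub : touching H U A0 \subset X :|: Y.
  apply/subsetP => e; rewrite inE => /andP[eH /andP[eA0 /pred0Pn[u /andP[/= ue uU]]]].
  have : #|e :\ u| == 2 by have := unif e eH; rewrite (cardsD1 u e) ue add1n => -[->].
  case/cards2P => x [y [xy exy]].
  have def_e : e = u |: [set x; y] by rewrite -exy setD1K.
  have [xu xe] : x != u /\ x \in e.
    by have : x \in e :\ u by [rewrite exy !inE eqxx]; rewrite !inE => /andP[].
  have [yu ye] : y != u /\ y \in e.
    by have : y \in e :\ u by [rewrite exy !inE eqxx orbT]; rewrite !inE => /andP[].
  rewrite inE; have [xA|xA] := boolP (x \in A); last first.
    apply/orP; right; apply/bigcupP; exists u => //; apply/bigcupP; exists x.
      by rewrite inE xA (subsetP eA0).
    by rewrite /E' eq_sym (negbTE xu) inE eH ue.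
  have [yA|yA] := boolP (y \in A); last first.
    apply/orP; right; apply/bigcupP; exists u => //; apply/bigcupP; exists y.
      by rewrite inE yA (subsetP eA0).
    by rewrite /E' eq_sym (negbTE yu) inE eH ue.
  apply/orP; left; apply/bigcupP; exists x => //; apply/bigcupP; exists y.
    rewrite inE yA eq_sym xy; apply/existsP; exists u.
    by rewrite uU -def_e eH.
  by rewrite /E' (negbTE xy) inE eH xe.
apply: leq_trans (subset_leq_card sub) _; apply: leq_trans (leq_card_setU _ _) _.
apply: leq_add; apply: card_bigcup_leq => x xA.
  apply: leq_trans (card_bigcup_leq (c := K) _) _ => //.
  by rewrite leq_mul2r small ?orbT.
exact: card_bigcup_leq.
Qed.

Definition sparse (V : finType) (H : {set {set V}}) (D : nat) : pred {set V} :=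
  fun A => [forall v in A, #|[set e in H | (v \in e) && (e \subset A)]| < D].

(** Invariant: [U] lies in [I], misses [A] and touches at least [#|U| * D] edges inside [A0]. While
    [A] is not sparse, a vertex of degree at least [D] in [A] is queried; a positive answer moves it
    to [U], a negative one only deletes it. Once [U] has [q] elements, [next] takes over. *)
Lemma covered_pick (V : finType) (H : {set {set V}}) (adm : {set V} -> Prop)
    (A0 A U : {set V}) D q j b' :
  A \subset A0 -> [disjoint U & A] ->
  (forall I, adm I -> U \subset I) ->
  #|U| + j = q -> #|U| * D <= #|touching H U A0| ->
  (forall (adm' : {set V} -> Prop) (A' U' : {set V}),
     A' \subset A -> #|U'| = q ->
     q * D <= #|touching H U' A0| ->
     (forall I, adm' I -> adm I /\ U' \subset I) ->
     covered (sparse H D) adm' A' b') ->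
  covered (sparse H D) adm A (j + b').
Proof.
elim: {A}#|A| {-2}A (leqnn #|A|) adm U j => [|k IH] A cA adm U j sA dU sUI cU tU next.
  apply: covered_leaf; apply/forallP => x.
  by move: cA; rewrite leqn0 cards_eq0 => /eqP ->; rewrite inE.
case: j cU => [|j] cU.
  by rewrite addn0 in cU; apply: (next adm A U) => //; rewrite -?cU // => I aI; split=> //; apply: sUI.
have [sp|] := boolP (sparse H D A); first exact: covered_leaf.
case/forallPn => v; rewrite negb_imply -leqNgt => /andP[vA dv].
have vU : v \notin U by apply: contraTN vA => vU; rewrite (disjointFr dU).
have sAv : A :\ v \subset A by apply: subsetDl.
have cAv : #|A :\ v| <= k by move: cA; rewrite (cardsD1 v A) vA.
rewrite addSn; apply: (@covered_query _ _ _ _ (A :\ v) (A :\ v) v) => //.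
- by move=> I aI vI; rewrite setD1K // subsetIr.
- move=> I aI vI; apply/subsetP => x /setIP[xI xA]; rewrite !inE xA andbT.
  by apply: contraNneq vI => <-.
- apply: (IH _ cAv _ (v |: U)).
  + exact: subset_trans sAv sA.
  + rewrite disjoint_sym disjoints_subset; apply/subsetP => x; rewrite !inE => /andP[xv xA].
    by rewrite (negbTE xv) (disjointFl dU).
  + by move=> I [aI vI]; rewrite subUset sub1set vI sUI.
  + by rewrite cardsU1 vU -cU /= add1n addnS addSn.
  (* The edges at [v] within [A] are new, since [U] is disjoint from [A]; they supply the additional
     [D]. *)
  + pose L := [set e in H | (v \in e) && (e \subset A)].
    have disj : touching H U A0 :&: L = set0.
      apply/setP => e; rewrite !inE; apply/negP => /andP[/andP[_ /andP[_ eU]] /andP[_ /andP[_ eA]]].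
      by move: eU; rewrite disjoint_sym (disjointWr eA dU).
    have sub : touching H U A0 :|: L \subset touching H (v |: U) A0.
      apply/subsetP => e; rewrite !inE => /orP[/andP[-> /andP[-> /= eU]]|].
        by apply: contra eU; apply: disjointWr; apply: subsetUr.
      case/andP => -> /andP[ve eA]; rewrite (subset_trans eA sA) /=.
      by apply/pred0Pn; exists v; rewrite /= ve !inE eqxx.
    apply: leq_trans (subset_leq_card sub).
    rewrite (cardsU (touching H U A0)) disj cards0 subn0 cardsU1 vU mulnDl mul1n addnC.
    exact: leq_add.
  + move=> adm' A' U' sA' cU' tU' h; apply: (next adm' A' U') => //.
      exact: subset_trans sA' sAv.
    by move=> I /h [[]].
- rewrite -addSn; apply: (IH _ cAv _ U) => //.
  + exact: subset_trans sAv sA.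
  + by apply: disjointWr dU.
  + by move=> I [aI _]; apply: sUI.
  + move=> adm' A' U' sA' cU' tU' h; apply: (next adm' A' U') => //.
      exact: subset_trans sA' sAv.
    by move=> I /h [[]].
Qed.

(* One round selects [q] vertices [U] of large degree and then runs the
   link-graph algorithm. By [card_touching], the [q * D] edges touching [U] can
   only be accounted for if [A] has lost more than [s] vertices. *)
Lemma covered_rounds (V : finType) (H : {set {set V}}) K D d q s b r :
  (forall e, e \in H -> #|e| = 3) ->
  (forall x y, x != y -> #|[set e in H | (x \in e) && (y \in e)]| <= K) ->
  0 < d -> #|V| <= b * d -> #|V| * (d * K) + q * (s * K) < q * D ->
  forall (adm : {set V} -> Prop) (A : {set V}),
    (forall I e, adm I -> e \in H -> ~~ (e \subset I)) ->
    #|A| <= r * s.+1 -> covered (sparse H D) adm A (r * (q + b)).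
Proof.
move=> unif codeg d0 nbd ineq; elim: r => [|r IH] adm A indI cA.
  apply: covered_leaf; apply/forallP => x.
  by move: cA; rewrite mul0n leqn0 cards_eq0 => /eqP ->; rewrite inE.
rewrite mulSn -addnA; apply: (@covered_pick _ _ _ A _ set0 _ q) => //.
- by rewrite disjoint_sym disjoints_subset setC0 subsetT.
- by move=> I _; apply: sub0set.
- by rewrite cards0.
- by rewrite cards0.
move=> adm' A' U' sA' cU' tU' h.
have indI' I e : adm' I -> e \in H -> ~~ (e \subset I) by move=> /h[aI _]; apply: indI.
apply: (@covered_link _ H _ _ U') (d0) _ _ _ _ => //.
- by move=> I /h[].
- move=> A'' sA'' small; apply: IH => //.
  have := @card_touching _ H U' A A'' K d unif codeg (fun x xA => ltnW (small x xA)).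
  have := max_card A''; rewrite cU' cardsDS; last exact: subset_trans sA'' sA'.
  have := subset_leq_card (subset_trans sA'' sA').
  move: tU' cA; set t := #|touching _ _ _|; set a := #|A|; set a'' := #|A''|.
  move=> tU' cA la''a la''n tle.
  have h1 : a'' * (d * K) <= #|V| * (d * K) by rewrite leq_mul2r la''n orbT.
  have h2 : q * (s * K) < q * ((a - a'') * K) by lia.
  have h3 : s < a - a''.
    by rewrite ltnNge; apply/negP => h3; move: h2; rewrite ltnNge !leq_mul.
  by lia.
- by apply: leq_trans nbd; apply: max_card.
Qed.

Lemma sparse_edges (V : finType) (H : {set {set V}}) D (A : {set V}) :
  (forall e, e \in H -> #|e| = 3) -> sparse H D A ->
  #|[set e in H | e \subset A]| <= #|V| * D.
Proof.
move=> unif /forallP sp.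
have sub : [set e in H | e \subset A] \subset
    \bigcup_(v in A) [set e in H | (v \in e) && (e \subset A)].
  apply/subsetP => e; rewrite inE => /andP[eH eA].
  have /card_gt0P[v ve] : 0 < #|e| by rewrite unif.
  by apply/bigcupP; exists v; rewrite ?(subsetP eA) // inE eH ve.
apply: leq_trans (subset_leq_card sub) _.
apply: leq_trans (card_bigcup_leq (c := D) _) _.
  by move=> v vA; apply: ltnW; have := sp v; rewrite vA.
by rewrite leq_mul2r max_card orbT.
Qed.

(** [covered_rounds] is run with [z = 4 * a * K] rounds. Each picks [z * t] vertices of large
    degree, then at most [t] more in the link graph with threshold [t], hence the bound
    [z * (z + 1) * t]. Degrees below [n %/ a] leave at most [n ^ 2 / a] edges. *)
Lemma containers (V : finType) (H : {set {set V}}) K a t :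
  (forall e, e \in H -> #|e| = 3) ->
  (forall x y, x != y -> #|[set e in H | (x \in e) && (y \in e)]| <= K) ->
  0 < K -> 0 < a -> 2 * a <= #|V| -> #|V| <= t * t ->
  exists f : {set V} -> {set V}, forall I : {set V},
    (forall e, e \in H -> ~~ (e \subset I)) ->
    exists T : {set V}, [/\ T \subset I,
      #|T| <= 4 * a * K * (4 * a * K + 1) * t, I \subset T :|: f T &
      a * #|[set e in H | e \subset f T]| <= #|V| * #|V|].
Proof.
move=> unif codeg K0 a0 la nt; set n := #|V| in la nt *.
have n0 : 0 < n by lia.
have t0 : 0 < t by case: (t) nt => //; lia.
pose z := 4 * a * K; have z0 : 0 < z by rewrite !muln_gt0 a0 K0.
(* Dividing [n.-1] rather than [n] makes [s * z < n] strict and keeps [n <= z * s.+1], so [z] rounds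
   exhaust all vertices. *)
pose D := n %/ a; pose s := n.-1 %/ z.
have lD : n < 2 * (a * D).
  have := ltn_ceil n a0; rewrite -/D; have : 0 < D by rewrite divn_gt0 //; lia.
  by nia.
have ls : s * z < n by have := leq_trunc_div n.-1 z; rewrite -/s; lia.
have ls' : n <= z * s.+1.
  by have := ltn_ceil n.-1 z0; rewrite -/s mulnC; lia.
(* After cancelling [t], the left side is below [2 * n * K], which [z * D = 4 * a * K * D] exceeds
   because [n < 2 * a * D]. *)
have ineq : n * (t * K) + (z * t) * (s * K) < (z * t) * D.
  have -> : n * (t * K) + z * t * (s * K) = t * (n * K + s * z * K) by nia.
  have -> : z * t * D = t * (z * D) by nia.
  rewrite ltn_mul2l t0 /=.
  have h1 : s * z * K < n * K by rewrite ltn_mul2r K0.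
  have -> : z * D = 2 * K * (2 * (a * D)) by rewrite /z; nia.
  have : 2 * K * n < 2 * K * (2 * (a * D)) by rewrite ltn_mul2l lD muln_gt0 K0.
  by nia.
have [f hf] := @covered_rounds V H K D t (z * t) s t z unif codeg t0 nt ineq
  (fun I => forall e, e \in H -> ~~ (e \subset I)) setT
  (fun I e h => h e) ltac:(by rewrite cardsT).
exists f => I /hf [T [sT cT iT gT]]; exists T; split.
- by move: sT; rewrite setIT.
- by move: cT; rewrite /z; congr (_ <= _); nia.
- by move: iT; rewrite setIT.
- have := sparse_edges unif gT; rewrite -/n => h.
  apply: leq_trans (leq_mul (leqnn a) h) _.
  by rewrite mulnCA leq_mul2l mulnC leq_trunc_div orbT.
Qed.

(** * Counting *)

(** The quotient of the binomials is a product of factors [(N - i) / (M - i)], each at most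
    [N / M]. *)
Lemma bin_mul_expn N M k : N <= M -> 'C(N, k) * M ^ k <= N ^ k * 'C(M, k).
Proof.
move=> NM; elim: k => [|k IH]; first by rewrite !bin0.
rewrite -(leq_pmul2l (ltn0Sn k)) !expnS.
have -> : k.+1 * ('C(N, k.+1) * (M * M ^ k)) = (N - k) * M * ('C(N, k) * M ^ k).
  by rewrite mulnA mul_bin_left; lia.
have -> : k.+1 * (N * N ^ k * 'C(M, k.+1)) = N * (M - k) * (N ^ k * 'C(M, k)).
  by rewrite mulnCA mul_bin_left; lia.
apply: leq_mul => //; rewrite mulnBl mulnBr leq_sub2l //.
by rewrite mulnC leq_mul2l NM orbT.
Qed.

(** Lowering the bottom index from [i + 1] to [i] costs a factor [(i + 1) / (M - i)], at most
    [m / (M - m)] for [i < m]. *)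
Lemma bin_sub_mul_expn M m j :
  j <= m -> 'C(M, m - j) * (M - m) ^ j <= m ^ j * 'C(M, m).
Proof.
elim: j => [|j IH] jm; first by rewrite subn0 !expn0 muln1 mul1n.
have {IH} := IH (ltnW jm); rewrite -(subSS j m) subSn // !expnS.
set i := m - j.+1 => IH.
have h : (M - m) * 'C(M, i) <= m * 'C(M, i.+1).
  apply: (@leq_trans ((M - i) * 'C(M, i))).
    by rewrite leq_mul2r leq_sub2l ?orbT // leq_subr.
  by rewrite -mul_bin_left leq_mul2r /i -subSn // subSS leq_subr orbT.
rewrite mulnA (mulnC 'C(M, i)); apply: leq_trans (leq_mul h (leqnn _)) _.
by rewrite -mulnA -[leqRHS]mulnA leq_mul2l IH orbT.
Qed.

Lemma bin_mul_fact_leq g k : 'C(g, k) * k`! <= g ^ k.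
Proof.
rewrite bin_ffact; elim: k => [|k IH]; first by rewrite ffactn0.
by rewrite ffactnSr expnSr leq_mul // leq_subr.
Qed.

Lemma card_between (V : finType) (T C : {set V}) m :
  #|[set I : {set V} | [&& T \subset I, I \subset T :|: C & #|I| == m]]|
    <= 'C(#|C|, m - #|T|).
Proof.
rewrite -cards_draws -(card_in_imset (f := fun I : {set V} => I :\: T)); last first.
  move=> I J; rewrite !inE => /and3P[TI _ _] /and3P[TJ _ _] e.
  by rewrite -(setID I T) -(setID J T) (setIidPr TI) (setIidPr TJ) e.
apply: subset_leq_card; apply/subsetP => J /imsetP[I].
rewrite !inE => /and3P[TI IC /eqP <-] ->.
by rewrite subDset IC cardsDS ?eqxx.
Qed.

(** Here [k] counts the elements of [I :\: T] outside [X]. As [I :\: X] has at most [k + #|T|]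
    elements, being far from [X] bounds [k] from below. *)
Lemma card_between_far (V : finType) (T C X : {set V}) m p :
  #|[set I : {set V} | [&& T \subset I, I \subset T :|: C, #|I| == m
      & m <= p * #|I :\: X|]]|
    <= \sum_(k < (m - #|T|).+1 | m <= p * (k + #|T|))
         'C(#|C :\: X|, k) * 'C(#|X|, m - #|T| - k).
Proof.
set F := [set _ | _].
pose S (k : nat) := [set I in F | #|(I :\: T) :\: X| == k].
have sub : F \subset \bigcup_(k < (m - #|T|).+1 | m <= p * (k + #|T|)) S k.
  apply/subsetP => I IF; have := IF; rewrite inE => /and4P[TI _ /eqP cI far].
  have lk : #|(I :\: T) :\: X| < (m - #|T|).+1.
    by rewrite ltnS -cI -cardsDS //; apply: subset_leq_card; apply: subsetDl.
  apply/bigcupP; exists (Ordinal lk) => /=; last by rewrite inE IF /=.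
  apply: leq_trans far _; rewrite leq_mul2l; apply/orP; right.
  have s : I :\: X \subset ((I :\: T) :\: X) :|: T.
    by apply/subsetP => x; rewrite !inE => /andP[-> ->]; case: (x \in T).
  by apply: leq_trans (subset_leq_card s) (leq_card_setU _ _).
apply: leq_trans (subset_leq_card sub) _.
apply: leq_trans (card_bigcup_leq_sum _ _) _; apply: leq_sum => -[k /= _] _.
rewrite -!cards_draws -cardsX.
rewrite -(card_in_imset (f := fun I : {set V} => ((I :\: T) :\: X, (I :\: T) :&: X))).
  apply: subset_leq_card; apply/subsetP => _ /imsetP[I + ->].
  rewrite !inE => /andP[/and4P[TI IC /eqP <- _] /eqP <-] /=.
  rewrite eqxx subsetIr setSD ?subDset //= -cardsDS //.
  by rewrite -(cardsID X (I :\: T)) addnK.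
move=> I J; rewrite !inE => /andP[/and4P[TI _ _ _] _] /andP[/and4P[TJ _ _ _] _] [e1 e2].
have e : I :\: T = J :\: T by rewrite -(setID (I :\: T) X) -(setID (J :\: T) X) e1 e2.
by rewrite -(setID I T) -(setID J T) (setIidPr TI) (setIidPr TJ) e.
Qed.

Lemma card_by_fingerprint (V : finType) (F : {set {set V}})
    (P : {set V} -> {set {set V}}) S :
  (forall I, I \in F -> exists T : {set V}, #|T| <= S /\ I \in P T) ->
  #|F| <= \sum_(s < S.+1) 'C(#|V|, s) * \max_(T : {set V} | #|T| == s) #|P T|.
Proof.
move=> h.
have sub : F \subset \bigcup_(s < S.+1) \bigcup_(T in [set T : {set V} | #|T| == s]) P T.
  apply/subsetP => I /h [T [cT IT]]; apply/bigcupP.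
  exists (Ordinal (cT : #|T| < S.+1)) => //.
  by apply/bigcupP; exists T; rewrite ?inE.
apply: leq_trans (subset_leq_card sub) _.
apply: leq_trans (card_bigcup_leq_sum _ _) _; apply: leq_sum => s _.
rewrite -(card_draws V s); apply: card_bigcup_leq => T; rewrite inE => cT.
exact: (leq_bigmax_cond (F := fun T => #|P T|)).
Qed.

(** * Exponential bounds over the reals *)

Local Open Scope R_scope.

Lemma INR_leq (m n : nat) : (m <= n)%nat -> INR m <= INR n.
Proof. by move=> /leP; apply: le_INR. Qed.

Lemma INR_muln (m n : nat) : INR (m * n)%nat = INR m * INR n.
Proof. exact: mult_INR. Qed.

Lemma INR_expn (m n : nat) : INR (m ^ n)%nat = INR m ^ n.
Proof. by elim: n => [//|n IH]; rewrite expnS INR_muln IH. Qed.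

Lemma INR_fact_gt0 (k : nat) : 0 < INR k`!.
Proof. by apply: lt_0_INR; apply/ltP; apply: fact_gt0. Qed.

Lemma exp_mul_INR (s : nat) x : exp (INR s * x) = exp x ^ s.
Proof.
elim: s => [|s IH]; first by rewrite Rmult_0_l exp_0.
by rewrite S_INR Rmult_plus_distr_r Rmult_1_l exp_plus IH /= Rmult_comm.
Qed.

Lemma pow_le_exp y (s : nat) : 0 <= y -> y ^ s <= exp (INR s * y).
Proof.
move=> y0; rewrite exp_mul_INR; apply: pow_incr; split=> //.
by have := exp_ineq1_le y; lra.
Qed.

Lemma INR_sum_le_exp (P : pred nat) (F : nat -> nat) c y (S : nat) :
  0 <= c -> 0 <= y ->
  (forall s, (s < S)%nat -> P s -> INR (F s) <= c * (y ^ s / INR s`!)) ->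
  INR (\sum_(s < S | P s) F s) <= c * exp y.
Proof.
move=> c0 y0 h.
have term k : 0 <= y ^ k / INR k`!.
  apply: Rmult_le_pos; first exact: pow_le.
  by apply: Rlt_le; apply: Rinv_0_lt_compat; apply: INR_fact_gt0.
pose t k := y ^ k / INR k`!.
(* [sum_f_R0 t S] includes the term of index [S], which the sum over [s < S] omits; it is added on
   the left. *)
have part : INR (\sum_(s < S | P s) F s) + c * t S <= c * sum_f_R0 t S.
  elim: S h => [|S IH] h.
    by rewrite big_ord0 /=; lra.
  have -> : (\sum_(s < S.+1 | P s) F s =
      \sum_(s < S | P s) F s + (if P S then F S else 0))%nat.
    by rewrite big_mkcond big_ord_recr /= -big_mkcond.
  rewrite plus_INR tech5 Rmult_plus_distr_l.
  have hS : INR (if P S then F S else 0%nat) <= c * t S.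
    case: ifP => PS; first exact: h.
    by apply: Rmult_le_pos => //; apply: term.
  have := IH (fun s lt => h s (leqW lt)); lra.
have ct : 0 <= c * t S by apply: Rmult_le_pos => //; apply: term.
apply: Rle_trans (_ : c * sum_f_R0 t S <= _); first by lra.
apply: Rmult_le_compat_l => //; apply: sum_incr => //.
have := svalP (exist_exp y); rewrite -/(exp y) /exp_in => cv e e0.
have [N hN] := cv e e0; exists N => k kN; have := hN k kN.
rewrite (PartSum.sum_eq t (fun i => / INR (Factorial.fact i) * y ^ i)) // => i _.
rewrite /t /Rdiv Rmult_comm; congr (/ INR _ * _).
by elim: i => // i IH; rewrite factS IH.
Qed.

Lemma pow_div (x y : R) (j : nat) : (x / y) ^ j = x ^ j / y ^ j.
Proof. by rewrite /Rdiv Rpow_mult_distr pow_inv. Qed.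

Lemma le_div_of_mul_le x y z : 0 < y -> x * y <= z -> x <= z / y.
Proof.
move=> y0 h; apply: (Rmult_le_reg_r y) => //.
by rewrite /Rdiv Rmult_assoc Rinv_l ?Rmult_1_r //; lra.
Qed.

Lemma INR_bin_le (g k : nat) : INR 'C(g, k) <= INR g ^ k / INR k`!.
Proof.
apply: le_div_of_mul_le (INR_fact_gt0 k) _.
by rewrite -INR_expn -INR_muln; apply: INR_leq; apply: bin_mul_fact_leq.
Qed.

Lemma INR_bin_sub_le (M m j : nat) y :
  0 < y -> y <= INR M - INR m -> (j <= m)%nat ->
  INR 'C(M, m - j) <= (INR m / y) ^ j * INR 'C(M, m).
Proof.
move=> y0 yM jm; have yj : 0 < y ^ j by apply: pow_lt.
have mM : (m <= M)%nat by apply/leP; apply: INR_le; lra.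
rewrite pow_div /Rdiv Rmult_assoc (Rmult_comm (/ _)) -Rmult_assoc.
apply: le_div_of_mul_le => //.
apply: Rle_trans (_ : INR 'C(M, m - j) * INR (M - m)%nat ^ j <= _).
  apply: Rmult_le_compat_l; first exact: pos_INR.
  by apply: pow_incr; rewrite minus_INR; [lra | apply/leP].
by rewrite -!INR_expn -!INR_muln; apply: INR_leq; apply: bin_sub_mul_expn.
Qed.

Lemma INR_bin_contract (N M k : nat) eta :
  0 < INR M -> 0 <= eta -> INR N <= (1 - eta) * INR M ->
  INR 'C(N, k) <= exp (- eta * INR k) * INR 'C(M, k).
Proof.
move=> M0 eta0 hN.
have NM : (N <= M)%nat by apply/leP; apply: INR_le; nra.
have Mk : 0 < INR M ^ k by apply: pow_lt.
apply: (Rmult_le_reg_r (INR M ^ k)) => //.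
apply: Rle_trans (_ : INR N ^ k * INR 'C(M, k) <= _).
  by rewrite -!INR_expn -!INR_muln; apply: INR_leq; apply: bin_mul_expn.
rewrite (Rmult_comm (exp _ * _)) -Rmult_assoc.
apply: Rmult_le_compat_r; first exact: pos_INR.
rewrite (Rmult_comm (- eta)) exp_mul_INR -Rpow_mult_distr.
apply: pow_incr; split; first exact: pos_INR.
by have := exp_ineq1_le (- eta); nra.
Qed.

(* The sum [\sum_s 'C(n, s) * (m / (beta n)) ^ s] is at most
   [\sum_s (beta theta)^-s * (theta m) ^ s / s!], in which the first factor is
   at most [exp (theta m)]. *)
Lemma INR_card_by_fingerprint (V : finType) (F : {set {set V}})
    (P : {set V} -> {set {set V}}) (S m : nat) b beta theta :
  0 < INR #|V| -> 0 <= b -> 0 < beta -> 0 < theta ->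
  INR S <= beta * theta ^ 2 * INR m ->
  (forall I, I \in F -> exists T : {set V}, (#|T| <= S)%nat /\ I \in P T) ->
  (forall T : {set V}, (#|T| <= S)%nat ->
     INR #|P T| <= b * (INR m / (beta * INR #|V|)) ^ #|T|) ->
  INR #|F| <= b * exp (2 * theta * INR m).
Proof.
move=> n0 b0 be0 th0 lS cov bnd.
have m0 := pos_INR m.
have bt0 : 0 < beta * theta by nra.
apply: Rle_trans (INR_leq (card_by_fingerprint cov)) _.
have -> : 2 * theta * INR m = theta * INR m + theta * INR m by ring.
rewrite exp_plus -Rmult_assoc.
apply: (@INR_sum_le_exp xpredT (fun s => 'C(#|V|, s) * \max_(T : {set V} | #|T| == s) #|P T|)%nat).
- by apply: Rmult_le_pos => //; apply: Rlt_le; apply: exp_pos.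
- by nra.
move=> s lsS _; set G := bigop _ _ _; rewrite INR_muln.
set w := INR m / (beta * INR #|V|) in bnd.
have w0 : 0 <= w.
  by apply: Rmult_le_pos => //; apply: Rlt_le; apply: Rinv_0_lt_compat; nra.
have hG : INR G <= b * w ^ s.
  rewrite /G; elim/big_ind: _ => [|x y hx hy|T /eqP cT].
  - by apply: Rmult_le_pos => //; apply: pow_le.
  - by rewrite /maxn; case: ifP.
  - by rewrite -cT; apply: bnd; rewrite cT -ltnS.
have f0 := INR_fact_gt0 s.
apply: Rle_trans (_ : INR #|V| ^ s / INR s`! * (b * w ^ s) <= _).
  by apply: Rmult_le_compat => //; [exact: pos_INR | exact: pos_INR | exact: INR_bin_le].
have -> : INR #|V| ^ s / INR s`! * (b * w ^ s)
    = b * (/ (beta * theta)) ^ s * ((theta * INR m) ^ s / INR s`!).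
  have e : INR #|V| ^ s * w ^ s = (/ (beta * theta)) ^ s * (theta * INR m) ^ s.
    by rewrite -(Rpow_mult_distr _ w) -Rpow_mult_distr; congr (_ ^ s); rewrite /w; field; lra.
  rewrite /Rdiv.
  have -> : INR #|V| ^ s * / INR s`! * (b * w ^ s) = b * (INR #|V| ^ s * w ^ s) * / INR s`! by ring.
  by rewrite e; ring.
apply: Rmult_le_compat_r.
  apply: Rmult_le_pos; first by apply: pow_le; nra.
  by apply: Rlt_le; apply: Rinv_0_lt_compat.
apply: Rmult_le_compat_l => //.
have i0 : 0 < / (beta * theta) by apply: Rinv_0_lt_compat.
apply: Rle_trans (pow_le_exp s (Rlt_le _ _ i0)) _.
have : INR s * / (beta * theta) <= theta * INR m.
  apply: (Rmult_le_reg_r (beta * theta)) => //.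
  rewrite Rmult_assoc Rinv_l; last by lra.
  by have := INR_leq (lsS : (s <= S)%nat); nra.
by case=> [/exp_increasing/Rlt_le|->] //; apply: Rle_refl.
Qed.

(** The case of a small container. At least half of the [m] elements lie outside [T], so contraction
    gains [exp (- eta m / 2)]. The power of [m / y] pays for passing from ['C(M, m - #|T|)] to
    ['C(M, m)]; [INR_card_by_fingerprint] absorbs it. *)
Lemma INR_card_between_small (V : finType) (T C : {set V}) (M m : nat) eta y :
  0 < INR M -> 0 <= eta -> INR #|C| <= (1 - eta) * INR M ->
  0 < y -> y <= INR M - INR m -> 2 * INR #|T| <= INR m ->
  INR #|[set I : {set V} | [&& T \subset I, I \subset T :|: C & #|I| == m]]|
    <= exp (- (eta / 2) * INR m) * INR 'C(M, m) * (INR m / y) ^ #|T|.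
Proof.
move=> M0 eta0 cC y0 yM cT.
have Tm : (#|T| <= m)%nat.
  by apply/leP; apply: INR_le; have := pos_INR #|T|; lra.
apply: Rle_trans (INR_leq (card_between _ _ _)) _.
apply: Rle_trans (INR_bin_contract _ M0 eta0 cC) _.
rewrite Rmult_assoc (Rmult_comm (INR _)).
apply: Rmult_le_compat; [by apply: Rlt_le; apply: exp_pos | exact: pos_INR | | exact: INR_bin_sub_le].
have : - eta * INR (m - #|T|)%nat <= - (eta / 2) * INR m.
  by rewrite minus_INR; [nra | apply/leP].
by case=> [/exp_increasing/Rlt_le|->] //; apply: Rle_refl.
Qed.

Lemma pow_le_anti x (i j : nat) : 0 <= x <= 1 -> (i <= j)%nat -> x ^ j <= x ^ i.
Proof.
move=> x01 /subnKC <-; rewrite Rdef_pow_add -[X in _ <= X]Rmult_1_r.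
apply: Rmult_le_compat_l; first by apply: pow_le; lra.
rewrite -(pow1 (j - i)); exact: pow_incr.
Qed.

(** The case of a container almost inside [X]. With [w = alpha * nu / 2], choosing [k] elements
    outside [X] contributes at most [(w * u ^ (2 * p)) ^ k / k!], and the smaller binomial inside
    [X] costs [(m / w) ^ (#|T| + k)]. The powers [w ^ k] cancel, [k >= m / (2 * p)] leaves at most
    [u ^ m], and the terms [m ^ k / k!] sum to at most [exp m]. *)
Lemma INR_card_between_far (V : finType) (T C X : {set V}) (M m p : nat)
    alpha u nu y :
  0 < alpha -> 0 < nu -> alpha * nu <= INR M -> (#|X| <= M)%nat ->
  0 < u -> INR p * u <= / 2 -> u <= 1 -> (0 < p)%nat -> (0 < m)%nat ->
  INR #|C :\: X| <= alpha / 2 * u ^ (2 * p) * nu ->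
  0 < y -> y <= alpha * nu / 2 -> (2 * p * #|T| <= m)%nat ->
  INR #|[set I : {set V} | [&& T \subset I, I \subset T :|: C, #|I| == m
      & (m <= p * #|I :\: X|)%nat]]|
    <= u ^ m * INR 'C(M, m) * (INR m / y) ^ #|T| * exp (INR m).
Proof.
move=> al0 nu0 alM XM u0 pu u1 p0 m0 cC y0 yal cT.
have m0' : 0 < INR m by apply: lt_0_INR; apply/ltP.
have Tm : (#|T| <= m)%nat by nia.
apply: Rle_trans (INR_leq (card_between_far _ _ _ _ _)) _.
set s := #|T| in cT Tm *; set g := #|C :\: X| in cC *.
set w := alpha * nu / 2; have w0 : 0 < w by rewrite /w; nra.
have c0 : 0 <= u ^ m * INR 'C(M, m) * (INR m / y) ^ s.
  apply: Rmult_le_pos; first by apply: Rmult_le_pos (pos_INR _); apply: pow_le; lra.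
  by apply: pow_le; apply: Rlt_le; apply: Rdiv_lt_0_compat.
apply: (@INR_sum_le_exp (fun k => m <= p * (k + s))%nat
  (fun k => 'C(g, k) * 'C(#|X|, m - s - k))%nat) => //; first by lra.
move=> k lk mk.
have f0 := INR_fact_gt0 k.
have t0 : 0 <= INR m ^ k / INR k`!.
  by apply: Rmult_le_pos; [apply: pow_le; lra | apply: Rlt_le; apply: Rinv_0_lt_compat].
(* A nonzero term has [m / (2 p) <= k <= g], which forces [m <= alpha nu / 2]. *)
have [gk|kg] := ltnP g k.
  by rewrite bin_small // mul0n; apply: Rmult_le_pos.
have m2pk : (m <= 2 * p * k)%nat by nia.
have up0 : 0 < u ^ (2 * p) by apply: pow_lt.
have mw : w <= INR M - INR m.
  have h1 := INR_leq m2pk; rewrite !INR_muln /= in h1.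
  have h2 := INR_leq kg.
  have h3 : u ^ (2 * p) <= u.
    by rewrite -[X in _ <= X]pow_1; apply: pow_le_anti; [lra | lia].
  have p0' := pos_INR p.
  have h4 : INR p * u ^ (2 * p) <= / 2.
    by apply: Rle_trans pu; apply: Rmult_le_compat_l.
  have h5 : INR p * INR k <= INR p * (alpha / 2 * u ^ (2 * p) * nu).
    by apply: Rmult_le_compat_l => //; lra.
  have h6 : alpha * nu * (INR p * u ^ (2 * p)) <= alpha * nu * / 2.
    by apply: Rmult_le_compat_l => //; nra.
  rewrite /w; nra.
have skm : (s + k <= m)%nat by lia.
have hX : INR 'C(#|X|, m - s - k) <= (INR m / w) ^ (s + k) * INR 'C(M, m).
  apply: Rle_trans (INR_bin_sub_le w0 mw skm); apply: INR_leq.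
  by rewrite -subnDA; apply: leq_bin2l.
have hg : INR 'C(g, k) <= (w * u ^ (2 * p)) ^ k / INR k`!.
  apply: Rle_trans (INR_bin_le _ _) _; apply: Rmult_le_compat_r.
    by apply: Rlt_le; apply: Rinv_0_lt_compat.
  apply: pow_incr; split; first exact: pos_INR.
  by rewrite /w; lra.
rewrite INR_muln; apply: Rle_trans (Rmult_le_compat _ _ _ _ (pos_INR _) (pos_INR _) hg hX) _.
have -> : (w * u ^ (2 * p)) ^ k / INR k`! * ((INR m / w) ^ (s + k) * INR 'C(M, m))
  = u ^ (2 * p * k) * INR 'C(M, m) * (INR m / w) ^ s * (INR m ^ k / INR k`!).
  rewrite (Rdef_pow_add _ s k) (pow_mult u (2 * p) k).
  have e : (w * u ^ (2 * p)) ^ k * (INR m / w) ^ k = (u ^ (2 * p)) ^ k * INR m ^ k.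
    by rewrite -!Rpow_mult_distr; congr (_ ^ k); field; lra.
  rewrite /Rdiv in e *.
  set a := (w * _) ^ k in e *; set b := (INR m * / w) ^ k in e *.
  set c := (INR m * / w) ^ s.
  have -> : a * / INR k`! * (c * b * INR 'C(M, m)) = a * b * / INR k`! * c * INR 'C(M, m) by ring.
  by rewrite e; ring.
apply: Rmult_le_compat_r => //.
have iw : INR m / w <= INR m / y.
  by apply: Rmult_le_compat_l; [lra | apply: Rinv_le_contravar => //].
have w1 : 0 <= INR m / w by apply: Rlt_le; apply: Rdiv_lt_0_compat.
apply: Rmult_le_compat.
- by apply: Rmult_le_pos (pos_INR _); apply: pow_le; lra.
- exact: pow_le.
- by apply: Rmult_le_compat_r; [exact: pos_INR | apply: pow_le_anti; [lra | ]].
- by apply: pow_incr.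
Qed.

Lemma INR_sum_le_const (I : finType) (A : {set I}) (F : I -> nat) b :
  (forall i, i \in A -> INR (F i) <= b) ->
  INR (\sum_(i in A) F i) <= INR #|A| * b.
Proof.
move=> h; rewrite -sum1_card.
elim/big_rec2: _ => [|i x z iA IH]; first by rewrite /=; lra.
by rewrite !plus_INR; have := h i iA; rewrite /=; lra.
Qed.

Lemma codeg2_leq (n : nat) (H : hgraph n) (x y : 'I_n) :
  x != y -> (#|[set e in H | (x \in e) && (y \in e)]| <= codeg2 H)%nat.
Proof.
move=> xy; have c2 : #|[set x; y]| == 2%nat by rewrite cards2 xy.
apply: leq_trans (leq_bigmax_cond _ c2); apply: subset_leq_card.
apply/subsetP => e; rewrite !inE => /andP[-> /andP[xe ye]].
by rewrite subUset !sub1set xe ye.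
Qed.

Lemma RlebP x y : reflect (x <= y) (Rleb x y).
Proof. by rewrite /Rleb; case: Rle_dec => h; constructor. Qed.

Lemma sqrt_ceil (n : nat) : (0 < n)%nat ->
  exists t : nat, (n <= t * t)%nat /\ INR t <= 2 * sqrt (INR n).
Proof.
move=> n0; have [h1 h2] := PeanoNat.Nat.sqrt_spec n (le_0_n n).
set s := PeanoNat.Nat.sqrt n in h1 h2; exists s.+1; split.
  by apply/leP; apply: PeanoNat.Nat.lt_le_incl.
have n1 : 1 <= INR n by apply: (INR_leq n0).
have s1 : 1 <= sqrt (INR n) by rewrite -sqrt_1; apply: sqrt_le_1; lra.
have : INR s <= sqrt (INR n).
  rewrite -(sqrt_square (INR s)); last exact: pos_INR.
  by apply: sqrt_le_1_alt; rewrite -mult_INR; apply: le_INR.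
by rewrite S_INR; lra.
Qed.

(** As [1 / p <= delta], the distance condition becomes an inequality of natural numbers, the form
    used in the counting lemmas. *)
Lemma SFgeP (n : nat) (H : hgraph n) (B : {set {set 'I_n}}) delta (m p : nat)
    (I : {set 'I_n}) :
  1 <= INR p * delta -> I \in SFge H B delta m ->
  [/\ forall e, e \in H -> ~~ (e \subset I), #|I| = m &
      forall X, X \in B -> (m <= p * #|I :\: X|)%nat].
Proof.
move=> pd; rewrite !inE => /andP[/andP[/forallP ind /eqP cI] /forallP far]; split=> //.
  by move=> e eH; have := ind e; rewrite eH.
move=> X XB; have := far X; rewrite XB => /RlebP h.
apply/leP; apply: INR_le; rewrite INR_muln.
have := pos_INR m; have := pos_INR p; nra.
Qed.

(** * Choice of constants and the union bound *)

Theorem theorem4p1 (alpha : R) (H : forall n : nat, hgraph n)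
    (B : forall n : nat, {set {set 'I_n}}) :
  0 < alpha ->
  (forall n, uniform3 (H n)) ->
  stable alpha H B ->
  (* e(H_n) = Theta(n^2) *)
  (exists c1 c2 : R, exists N0 : nat, 0 < c1 /\ 0 < c2 /\
     forall n, (N0 <= n)%nat ->
       c1 * INR n ^ 2 <= INR (nedges (H n)) <= c2 * INR n ^ 2) ->
  (* Delta_2(H_n) = O(1) *)
  (exists K : nat, forall n, (codeg2 (H n) <= K)%nat) ->
  (forall n, alpha * INR n <= INR (maxsize (B n))) ->
  forall delta : R, 0 < delta ->
  exists C eps : R, 0 < C /\ 0 < eps /\
  exists N : nat, forall n m : nat, (N <= n)%nat ->
    C * sqrt (INR n) <= INR m ->
    INR #|SFge (H n) (B n) delta m| <=
      (Rpower 2 (- (eps * INR m)) + delta ^ m * INR #|B n|)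
        * INR 'C(maxsize (B n), m).
Proof.
move=> al0 unif stab [c1 [c2 [N0 [c10 [_ edges]]]]] [K codeg] maxB delta de0.
(* [delta] may be replaced by [1 / p <= delta], and then [9] bounds [exp 2]. *)
have [p hp] := INR_unbounded (/ delta).
have pR : 0 < INR p by have := Rinv_0_lt_compat _ de0; lra.
have p0 : (0 < p)%nat by apply/ltP; apply: INR_lt.
have p1 : 1 <= INR p := INR_leq p0.
have pd : 1 <= INR p * delta.
  by have -> : 1 = / delta * delta; [rewrite Rinv_l; lra | nra].
pose u := / (9 * INR p).
have u0 : 0 < u by apply: Rinv_0_lt_compat; lra.
have pu : INR p * u = / 9 by rewrite /u; field; lra.
have u1 : u <= 1 by nra.
(* This is the density allowed for [C :\: X] in [INR_card_between_far]. *)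
pose gamma := alpha / 2 * u ^ (2 * p).
have up0 : 0 < u ^ (2 * p) by apply: pow_lt.
have upu : u ^ (2 * p) <= u.
  by rewrite -[X in _ <= X]pow_1; apply: pow_le_anti; [lra | lia].
have ga0 : 0 < gamma by rewrite /gamma; nra.
have [beta0 [be00 hst]] := stab gamma ga0.
(* The cap [alpha / 2] makes [y = beta * n] admissible in [INR_card_between_far] and gives
   [eta <= 1 / 2]. *)
pose beta := Rmin beta0 (alpha / 2).
have be0 : 0 < beta by apply: Rmin_glb_lt => //; lra.
have beb : beta <= beta0 by apply: Rmin_l.
have bea : beta <= alpha / 2 by apply: Rmin_r.
pose eta := beta / alpha; have eta0 : 0 < eta by apply: Rdiv_lt_0_compat.
have etaE : eta * alpha = beta by rewrite /eta; field; lra.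
have eta1 : eta <= / 2 by nra.
(* Choosing [T] then costs [exp (eta m / 4)], against a gain of [exp (- eta m / 2)] from small
   containers. *)
pose theta := eta / 8; have th0 : 0 < theta by rewrite /theta; lra.
(* Fingerprints will have size at most [sigma * m]: the first bound serves
   [INR_card_by_fingerprint], the second gives [2 * p * #|T| <= m]. *)
pose sigma := Rmin (beta * theta ^ 2) (/ (2 * INR p)).
have si0 : 0 < sigma.
  apply: Rmin_glb_lt; last by apply: Rinv_0_lt_compat; lra.
  by apply: Rmult_lt_0_compat => //; apply: pow_lt.
have si1 : sigma <= beta * theta ^ 2 by apply: Rmin_l.
have si2 : sigma <= / (2 * INR p) by apply: Rmin_r.
(* Containers span at most [n ^ 2 / a] edges, which [a * beta * c1 > 1] puts below
   [beta * e(H_n)]. *)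
have [a ha] := INR_unbounded (/ (beta * c1)).
have bc0 : 0 < beta * c1 by nra.
have aR : 0 < INR a by have := Rinv_0_lt_compat _ bc0; lra.
have a0 : (0 < a)%nat by apply/ltP; apply: INR_lt.
have abc : 1 < INR a * (beta * c1).
  by have -> : 1 = / (beta * c1) * (beta * c1); [rewrite Rinv_l; lra | nra].
pose L := (4 * a * K.+1 * (4 * a * K.+1 + 1))%nat.
have L0 : 0 < INR L by apply: lt_0_INR; apply/ltP; rewrite /L; nia.
(* With this [C], fingerprints have size at most [L * t <= 2 * L * sqrt n <= sigma * m]. *)
exists (2 * INR L / sigma), (eta / 4); split; first by apply: Rdiv_lt_0_compat; lra.
split; first by lra.
exists (maxn N0 (2 * a)) => n m; rewrite geq_max => /andP[nN0 na] hm.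
have n0 : (0 < n)%nat by lia.
have nR : 0 < INR n by apply: lt_0_INR; apply/ltP.
have [e1 _] := edges n nN0.
have [t [nt tn]] := sqrt_ceil n0.
set S := (L * t)%nat.
have lS : INR S <= sigma * INR m.
  rewrite /S INR_muln.
  have : sigma * (2 * INR L / sigma * sqrt (INR n)) <= sigma * INR m by apply: Rmult_le_compat_l; lra.
  have -> : sigma * (2 * INR L / sigma * sqrt (INR n)) = INR L * (2 * sqrt (INR n)) by field; lra.
  by have := Rmult_le_compat_l _ _ _ (Rlt_le _ _ L0) tn; lra.
have mR : 0 < INR m.
  by apply: Rlt_le_trans hm; apply: Rmult_lt_0_compat; [apply: Rdiv_lt_0_compat; lra | apply: sqrt_lt_R0].
have m0 : (0 < m)%nat by apply/ltP; apply: INR_lt.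
set M := maxsize (B n); have hM : alpha * INR n <= INR M := maxB n.
have bin0 := pos_INR 'C(M, m).
have bound_ge0 : 0 <= (Rpower 2 (- (eta / 4 * INR m)) + delta ^ m * INR #|B n|) * INR 'C(M, m).
  apply: Rmult_le_pos => //; apply: Rplus_le_le_0_compat; first by apply: Rlt_le; apply: exp_pos.
  by apply: Rmult_le_pos (pos_INR _); apply: pow_le; lra.
have nH0 : 0 < INR (nedges (H n)) by apply: Rlt_le_trans e1; apply: Rmult_lt_0_compat => //; apply: pow_lt.
(* For large [m] stability applies to [I] itself: spanning no edge, [I] would be almost contained in
   some [X], contradicting its distance from [X]. Otherwise [M - m >= beta * n]. *)
have [big_m|small_m] := Rle_lt_dec ((alpha - beta) * INR n) (INR m).
  suff -> : SFge (H n) (B n) delta m = set0 by rewrite cards0.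
  apply/setP => I; rewrite [RHS]inE; apply/negP => /(SFgeP pd)[ind cI far].
  have [|e0|[X [XB hX]]] := hst n I.
  - by rewrite cI; nra.
  - have e : nedges_in (H n) I = 0%nat.
      apply/eqP; rewrite cards_eq0; apply/eqP/setP => e; rewrite !inE.
      by apply/negP => /andP[/ind/negP].
    by rewrite e /= in e0; nra.
  - have := INR_leq (far X XB); rewrite INR_muln => h.
    have h1 : INR p * INR #|I :\: X| <= INR p * (gamma * INR n) by apply: Rmult_le_compat_l; lra.
    have h2 : INR p * u ^ (2 * p) <= / 9 by rewrite -pu; apply: Rmult_le_compat_l; lra.
    have h3 : alpha * INR n * (INR p * u ^ (2 * p)) <= alpha * INR n * / 9.
      by apply: Rmult_le_compat_l => //; nra.
    by rewrite /gamma in h1; nra.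
have codegK x y : x != y -> (#|[set e in H n | (x \in e) && (y \in e)]| <= K.+1)%nat.
  by move=> xy; apply: leq_trans (codeg2_leq _ xy) _; apply: leqW.
have [f hf] := @containers 'I_n (H n) K.+1 a t (unif n) codegK isT a0
  ltac:(by rewrite card_ord) ltac:(by rewrite card_ord).
have {}hf (I : {set 'I_n}) : I \in SFge (H n) (B n) delta m ->
    exists T : {set 'I_n}, [/\ (#|T| <= S)%nat, T \subset I, I \subset T :|: f T &
      INR #|f T| <= (alpha - beta) * INR n \/
      exists X, X \in B n /\ INR #|f T :\: X| <= gamma * INR n].
  case/(SFgeP pd) => ind cI far; have [T [TI cT IT eT]] := hf I ind.
  exists T; split=> //.
  have [le|gt] := Rle_lt_dec (INR #|f T|) ((alpha - beta) * INR n); first by left.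
  right; have [|le|//] := hst n (f T).
    by apply: Rle_trans (Rlt_le _ _ gt); apply: Rmult_le_compat_r; lra.
  have := INR_leq eT; rewrite card_ord !INR_muln -/(nedges_in (H n) (f T)) => h.
  have h1 : beta * INR (nedges (H n)) <= INR (nedges_in (H n) (f T)) by nra.
  have h2 : INR a * (beta * (c1 * INR n ^ 2)) <= INR a * (beta * INR (nedges (H n))).
    by apply: Rmult_le_compat_l; [lra | apply: Rmult_le_compat_l; lra].
  have h3 : INR a * (beta * INR (nedges (H n))) <= INR a * INR (nedges_in (H n) (f T)).
    by apply: Rmult_le_compat_l; lra.
  have h4 : 1 * INR n ^ 2 < INR a * (beta * c1) * INR n ^ 2.
    by apply: Rmult_lt_compat_r => //; apply: pow_lt.
  by exfalso; rewrite /= in h2 h4; lra.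
(* Taking the empty set when the container of [T] fails the size condition makes the bounds below
   hold for every small [T]. *)
pose P1 (T : {set 'I_n}) := if Rleb (INR #|f T|) ((alpha - beta) * INR n) then
  [set I : {set 'I_n} | [&& T \subset I, I \subset T :|: f T & #|I| == m]] else set0.
pose P2 (X T : {set 'I_n}) := if Rleb (INR #|f T :\: X|) (gamma * INR n) then
  [set I : {set 'I_n} | [&& T \subset I, I \subset T :|: f T, #|I| == m
     & (m <= p * #|I :\: X|)%nat]] else set0.
pose U (P : {set 'I_n} -> {set {set 'I_n}}) :=
  [set I | [exists T : {set 'I_n}, (#|T| <= S)%nat && (I \in P T)]].
have UP P I : I \in U P -> exists T : {set 'I_n}, (#|T| <= S)%nat /\ I \in P T.
  by rewrite inE => /existsP[T /andP[? ?]]; exists T.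
have sub : SFge (H n) (B n) delta m \subset U P1 :|: \bigcup_(X in B n) U (P2 X).
  apply/subsetP => I IF; have [T [cT TI IT alt]] := hf I IF.
  have [ind cI far] := SFgeP pd IF; rewrite inE.
  case: alt => [le|[X [XB le]]]; apply/orP; [left | right].
    rewrite inE; apply/existsP; exists T; rewrite cT /P1.
    by move/RlebP: le => ->; rewrite inE TI IT cI /=.
  apply/bigcupP; exists X => //; rewrite inE; apply/existsP; exists T; rewrite cT /P2.
  by move/RlebP: le => ->; rewrite inE TI IT cI eqxx far.
have lS' : INR S <= beta * theta ^ 2 * INR m.
  by apply: Rle_trans lS _; apply: Rmult_le_compat_r; lra.
have cT2 (T : {set 'I_n}) : (#|T| <= S)%nat -> (2 * p * #|T| <= m)%nat.
  move=> /INR_leq cT; apply/leP; apply: INR_le; rewrite !INR_muln [INR 2]/=.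
  have : sigma * INR m <= / (2 * INR p) * INR m by apply: Rmult_le_compat_r; lra.
  move=> h; have {}h : INR #|T| <= / (2 * INR p) * INR m by lra.
  have -> : INR m = 2 * INR p * (/ (2 * INR p) * INR m) by field; lra.
  by apply: Rmult_le_compat_l; lra.
have V0 : 0 < INR #|'I_n| by rewrite card_ord.
have w0 : 0 <= INR m / (beta * INR n) by apply: Rlt_le; apply: Rdiv_lt_0_compat => //; nra.
have M0 : 0 < INR M by nra.
have bn0 : 0 < beta * INR n by nra.
have bnM : beta * INR n <= INR M - INR m by nra.
have b1 : INR #|U P1| <= Rpower 2 (- (eta / 4 * INR m)) * INR 'C(M, m).
  have bb0 : 0 <= exp (- (eta / 2) * INR m) * INR 'C(M, m).
    by apply: Rmult_le_pos => //; apply: Rlt_le; apply: exp_pos.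
  apply: Rle_trans (INR_card_by_fingerprint V0 bb0 be0 th0 lS' (UP P1) _) _.
    move=> T cT; rewrite card_ord /P1; case: RlebP => h; last first.
      by rewrite cards0; apply: Rmult_le_pos => //; apply: pow_le.
    apply: INR_card_between_small => //; first by lra.
      by apply: Rle_trans h _; nra.
    rewrite -[2]/(INR 2) -INR_muln; apply: INR_leq; apply: leq_trans (cT2 T cT).
    by rewrite leq_mul2r leq_pmulr ?orbT.
  rewrite Rmult_assoc (Rmult_comm (INR _)) -Rmult_assoc; apply: Rmult_le_compat_r => //.
  rewrite -exp_plus /Rpower.
  have ln2 : ln 2 <= 1.
    rewrite -[X in _ <= X]ln_exp; apply: Rlt_le; apply: ln_increasing; first by lra.
    by have : 1 <> 0 by [lra]; move/exp_ineq1; lra.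
  have : - (eta / 2) * INR m + 2 * theta * INR m <= - (eta / 4 * INR m) * ln 2.
    have : 0 <= eta / 4 * INR m by nra.
    by rewrite /theta; nra.
  by case=> [/exp_increasing/Rlt_le|->] //; apply: Rle_refl.
have b2 X : X \in B n -> INR #|U (P2 X)| <= delta ^ m * INR 'C(M, m).
  move=> XB; have XM : (#|X| <= M)%nat by exact: (leq_bigmax_cond (F := fun Y : {set 'I_n} => #|Y|) X XB).
  have bb0 : 0 <= u ^ m * INR 'C(M, m) * exp (INR m).
    apply: Rmult_le_pos; last by apply: Rlt_le; apply: exp_pos.
    by apply: Rmult_le_pos => //; apply: pow_le; lra.
  apply: Rle_trans (INR_card_by_fingerprint V0 bb0 be0 th0 lS' (UP (P2 X)) _) _.
    move=> T cT; rewrite card_ord /P2; case: RlebP => h; last first.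
      by rewrite cards0; apply: Rmult_le_pos => //; apply: pow_le.
    rewrite Rmult_assoc (Rmult_comm (exp _)) -Rmult_assoc.
    apply: (@INR_card_between_far _ _ _ _ M m p alpha u (INR n)) => //; try lra.
    - by nra.
    - exact: cT2.
  have -> : u ^ m * INR 'C(M, m) * exp (INR m) * exp (2 * theta * INR m)
      = u ^ m * exp (INR m + 2 * theta * INR m) * INR 'C(M, m) by rewrite exp_plus; ring.
  apply: Rmult_le_compat_r => //.
  (* As [theta <= 1 / 16], the exponent is at most [2 * m], and
     [u * exp 2 <= 9 * u = 1 / p <= delta]. *)
  apply: Rle_trans (_ : u ^ m * exp (INR m * (1 + 1)) <= _).
    apply: Rmult_le_compat_l; first by apply: pow_le; lra.
    have : INR m + 2 * theta * INR m <= INR m * (1 + 1) by rewrite /theta; nra.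
    by case=> [/exp_increasing/Rlt_le|->] //; apply: Rle_refl.
  rewrite exp_mul_INR -Rpow_mult_distr; apply: pow_incr; split.
    by apply: Rmult_le_pos; [lra | apply: Rlt_le; apply: exp_pos].
  rewrite exp_plus; have := exp_le_3; have := exp_pos 1 => e0 e3.
  have h : exp 1 * exp 1 <= 9 by nra.
  have hu : u * (exp 1 * exp 1) <= u * 9 by apply: Rmult_le_compat_l; lra.
  by apply: Rle_trans hu _; nra.
apply: Rle_trans (INR_leq (subset_leq_card sub)) _.
apply: Rle_trans (INR_leq (leq_card_setU _ _)) _.
rewrite plus_INR Rmult_plus_distr_r; apply: Rplus_le_compat => //.
apply: Rle_trans (INR_leq (card_bigcup_leq_sum _ _)) _.
by apply: Rle_trans (INR_sum_le_const b2) _; apply: Req_le; ring.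
Qed.
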